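(* For all $n\ge2$ and $t\ge1$, $$\mathcal{F}^+_t(\mathcal{C}^p_{2n})=\mathcal{F}_t(\mathcal{C}_{2n-2}),$$ i.e. the parity-restricted frame potential of the p-Clifford group on $2n$ Majorana modes equals the ordinary frame potential of the Majorana Clifford group on $2n-2$ modes (acting on a $2^{n-1}$-dimensional Hilbert space).
   Context: Majorana strings: for $m$ Hermitian operators $\chi_1,\dots,\chi_{2m}$ on a $2^m$-dimensional Hilbert space with $\chi_i\chi_k+\chi_k\chi_i=2\delta_{ik}I$, and $\omega_L$ the strictly lower triangular binary matrix of ones below the diagonal, $\mu(v)=i^{\,v^T\omega_L v}\chi_1^{v_1}\cdots\chi_{2m}^{v_{2m}}$ for $v\in\mathbb{F}_2^{2m}$. The Majorana Clifford group $\mathcal{C}_{2m}$ is the group of unitaries $\gamma$ with $\gamma\mu(v)\gamma^\dagger=c(v)\mu(S(v))$ for all $v$ (some $c,S$). With $j=(1,\dots,1)^T$, the p-Clifford group is $\mathcal{C}^p_{2m}=\{\gamma\in\mathcal{C}_{2m}:\gamma\mu(j)=\mu(j)\gamma\}$, and $\Pi_+=\frac12(I+\mu(j))$. Frame potentials, with expectations uniform over the group modulo global phases: $\mathcal{F}_t(\mathcal{G})=\mathbb{E}_{U,V\in\mathcal{G}}|\operatorname{tr}(UV^\dagger)|^{2t}$ and $\mathcal{F}^+_t(\mathcal{G})=\mathbb{E}_{U,V\in\mathcal{G}}|\operatorname{tr}(\Pi_+UV^\dagger)|^{2t}$. *)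

(* Defs.v *)
From HB Require Import structures.
From mathcomp Require Import all_boot all_order all_algebra.
From Stdlib Require Import ClassicalEpsilon.
Set Implicit Arguments. Unset Strict Implicit. Unset Printing Implicit Defensive.
Import Order.TTheory GRing.Theory Num.Theory.
Local Open Scope ring_scope.

Section Majorana.
Variable C : numClosedFieldType.

Definition adj (d : nat) (A : 'M[C]_d) : 'M[C]_d := (map_mx Num.conj A)^T.

Definition unitary (d : nat) (U : 'M[C]_d) : Prop := U *m adj U = 1%:M.

Definition majorana (m : nat) (chi : 'I_(2 * m) -> 'M[C]_(2 ^ m)) : Prop :=
  (forall i, adj (chi i) = chi i) /\
  (forall i k, chi i *m chi k + chi k *m chi i =
               (if i == k then 2 else 0)%:M).

(* v^T omega_L v, computed as an integer (number of pairs l < k with v_l = v_k = 1) *)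
Definition omegaL_form (m : nat) (v : {ffun 'I_(2 * m) -> bool}) : nat :=
  (\sum_(k < 2 * m) \sum_(l < 2 * m | (l < k)%N) (v k * v l))%N.

Definition mu (m : nat) (chi : 'I_(2 * m) -> 'M[C]_(2 ^ m))
    (v : {ffun 'I_(2 * m) -> bool}) : 'M[C]_(2 ^ m) :=
  'i ^+ (omegaL_form v) *: \prod_(k < 2 * m) (if v k then chi k else 1%:M).

Definition allones (m : nat) : {ffun 'I_(2 * m) -> bool} := [ffun => true].

Definition Clifford (m : nat) (chi : 'I_(2 * m) -> 'M[C]_(2 ^ m))
    (g : 'M[C]_(2 ^ m)) : Prop :=
  unitary g /\
  exists (c : {ffun 'I_(2 * m) -> bool} -> C)
         (S : {ffun 'I_(2 * m) -> bool} -> {ffun 'I_(2 * m) -> bool}),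
    forall v, g *m mu chi v *m adj g = c v *: mu chi (S v).

Definition pClifford (m : nat) (chi : 'I_(2 * m) -> 'M[C]_(2 ^ m))
    (g : 'M[C]_(2 ^ m)) : Prop :=
  Clifford chi g /\ g *m mu chi (allones m) = mu chi (allones m) *m g.

Definition Piplus (m : nat) (chi : 'I_(2 * m) -> 'M[C]_(2 ^ m)) : 'M[C]_(2 ^ m) :=
  2^-1 *: (1%:M + mu chi (allones m)).

Definition phase_eq (d : nat) (A B : 'M[C]_d) : Prop :=
  exists l : C, `|l| = 1 /\ A = l *: B.

Definition transversal (d : nat) (G : 'M[C]_d -> Prop) (s : seq 'M[C]_d) : Prop :=
  [/\ forall U, U \in s -> G U,
      forall g, G g -> exists2 U, U \in s & phase_eq g U
    & forall i j, (i < size s)%N -> (j < size s)%N ->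
        phase_eq (nth 0 s i) (nth 0 s j) -> i = j].

Definition reps (d : nat) (G : 'M[C]_d -> Prop) : seq 'M[C]_d :=
  epsilon (inhabits [::]) (transversal G).

Definition frame_pot_P (d : nat) (P : 'M[C]_d) (G : 'M[C]_d -> Prop) (t : nat) : C :=
  let s := reps G in
  (size s)%:R ^- 2 *
    \sum_(U <- s) \sum_(V <- s) `|\tr (P *m U *m adj V)| ^+ (2 * t).

Definition frame_pot (d : nat) (G : 'M[C]_d -> Prop) (t : nat) : C :=
  frame_pot_P 1%:M G t.

Definition frame_pot_plus (m : nat) (chi : 'I_(2 * m) -> 'M[C]_(2 ^ m))
    (G : 'M[C]_(2 ^ m) -> Prop) (t : nat) : C :=
  frame_pot_P (Piplus chi) G t.

End Majorana.

(* Main.v *)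
Require Import Defs.
From HB Require Import structures.
From mathcomp Require Import all_boot all_order all_algebra.
From Stdlib Require Import Classical ClassicalEpsilon.
Set Implicit Arguments. Unset Strict Implicit. Unset Printing Implicit Defensive.
Import Order.TTheory GRing.Theory Num.Theory.
Local Open Scope ring_scope.

(* Put P = mu(j) and Pi = (1 + P)/2.  The operators i chi_k chi_{2n} for k <= 2n-2 form
   a Majorana family commuting with Pi, so the averaging argument behind the uniqueness of
   the Clifford representation gives an isometry W of the 2^(n-1)-dimensional space onto
   the image of Pi that intertwines this family with chi'.  Compression g |-> W† g W is a
   homomorphism from the p-Clifford group to the Clifford group of chi' (even strings
   compress to strings), and it is onto: Q = chi_{2n-1} exchanges the two eigenspaces of P
   and commutes with the even family, so W h W† + Q W h W† Q is a p-Clifford preimage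
   of h.  Since tr(Pi U V†) is the trace of the product of the compressions, and the
   fibres of a surjective homomorphism have equal size, the two averages agree. *)

(** Stated over any ring, so that a single sign can serve families of matrices of different
    sizes. *)
Definition clifford_family (I : finType) (R : pzRingType) (f : I -> R) : Prop :=
  (forall k, f k * f k = 1) /\
  (forall k l, k != l -> f k * f l = - (f l * f k)).

(** * Signs of words in anticommuting involutions *)

Section Strings.
Variable I : finType.
Implicit Types (s : seq I) (x : I).

(** Each letter other than [x] contributes one sign, so the exponent is the size minus the
    multiplicity of [x]; the sum has the same parity and avoids truncated subtraction. *)
Lemma generator_move (R : pzRingType) (f : I -> R) s x : clifford_family f ->
  f x * \prod_(k <- s) f k =
  (-1) ^+ (size s + count_mem x s) * (\prod_(k <- s) f k * f x).
Proof.
move=> [f1 fA]; elim: s => [|y s IH]; first by rewrite big_nil mulr1 !mul1r.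
rewrite !big_cons /=; have [->|nyx] := eqVneq y x.
  rewrite {1}IH add1n addSn addnS !exprS !mulN1r opprK -!(signr_odd _ (_ + _)) !mulr_sign.
  by case: ifP; rewrite ?mulrN mulrA.
rewrite mulrA fA 1?eq_sym // add0n addSn exprS mulN1r !mulNr -!mulrA; congr (- _).
by rewrite IH -!(signr_odd _ (_ + _)) !mulr_sign; case: ifP; rewrite ?mulrN.
Qed.

(* The sign must not depend on the family: the two families compared by an
   intertwiner need the same one. *)
Lemma perm_prod_sign s1 s2 : perm_eq s1 s2 ->
  exists e : nat, forall (R : pzRingType) (f : I -> R), clifford_family f ->
    \prod_(k <- s1) f k = (-1) ^+ e * \prod_(k <- s2) f k.
Proof.
elim: s1 s2 => [|x s1 IH] s2.
  rewrite perm_sym => /perm_nilP ->; exists 0%N => R f _.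
  by rewrite big_nil mul1r.
move=> p12; have x2 : x \in s2 by rewrite -(perm_mem p12) mem_head.
case/splitPr: x2 p12 => a b p12.
have /IH[e He] : perm_eq s1 (a ++ b).
  by rewrite -(perm_cons x) (permPl p12) perm_catC /= perm_cons perm_catC.
exists (e + (size a + count_mem x a))%N => R f cf.
rewrite !big_cons !big_cat big_cons /= He // big_cat /=.
rewrite exprD -!mulrA -(signr_odd _ e) !mulr_sign.
have Ea := generator_move a x cf.
have {}Ea B : f x * (\prod_(k <- a) f k * B) =
   (-1) ^+ (size a + count_mem x a) * (\prod_(k <- a) f k * (f x * B)).
  by rewrite mulrA Ea -!mulrA.
by case: ifP => _; rewrite ?mulrN Ea.
Qed.

(** Equal letters can be brought together and cancel in pairs, so only letters of odd multiplicity
    survive. *)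
Lemma prod_sort_sign s :
  exists e : nat, forall (R : pzRingType) (f : I -> R), clifford_family f ->
    \prod_(k <- s) f k = (-1) ^+ e * \prod_(k | odd (count_mem k s)) f k.
Proof.
elim: s => [|x s [e He]].
  by exists 0%N => R f _; rewrite big_nil mul1r big_pred0.
pose t r := [seq k <- index_enum I | odd (count_mem k r)].
have tE (R : pzRingType) (f : I -> R) r :
  \prod_(k | odd (count_mem k r)) f k = \prod_(k <- t r) f k by rewrite big_filter.
have ut r : uniq (t r) by rewrite filter_uniq // index_enum_uniq.
have mt r k : (k \in t r) = odd (count_mem k r).
  by rewrite mem_filter mem_index_enum andbT.
(* If [x] survives in [s], the new copy cancels it; otherwise the new copy is inserted at its
   place. *)
have [ox|ox] := boolP (odd (count_mem x s)).
  have /perm_prod_sign[e' He'] : perm_eq (t s) (x :: t (x :: s)).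
    apply: uniq_perm; rewrite //= ?ut ?mt ?andbT /= ?eqxx ?oddD ?ox // => k.
    rewrite mt inE mt /= (eq_sym x); have [->|] := eqVneq k x; first by rewrite oddD ox.
    by [].
  exists (e + e')%N => R f cf; rewrite big_cons He // tE tE He' // big_cons.
  rewrite exprD -(signr_odd _ e) -(signr_odd _ e') -!mulrA !mulr_sign.
  by do 2!case: ifP => _; rewrite ?mulrN ?opprK mulrA cf.1 mul1r.
have /perm_prod_sign[e' He'] : perm_eq (x :: t s) (t (x :: s)).
  apply: uniq_perm; rewrite //= ?ut ?mt ?andbT ?ox // => k.
  rewrite mt inE mt /= (eq_sym x); have [->|] := eqVneq k x.
    by rewrite oddD (negPf ox).
  by [].
exists (e + e')%N => R f cf; rewrite big_cons He // tE tE.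
move: (He' R f cf); rewrite big_cons => H; rewrite exprD -mulrA -H.
by rewrite -(signr_odd _ e) !mulr_sign; case: ifP; rewrite ?mulrN.
Qed.

(** Reversal exchanges each pair of distinct letters exactly once, which gives one sign per pair. *)
Lemma prod_rev_sign (R : pzRingType) (f : I -> R) s : clifford_family f -> uniq s ->
  \prod_(k <- rev s) f k = (-1) ^+ 'C(size s, 2) * \prod_(k <- s) f k.
Proof.
move=> cf; elim: s => [|x s IH]; first by rewrite big_nil mul1r.
move=> /= /andP[xs us]; rewrite rev_cons -cats1 big_cat big_seq1 /= IH // big_cons.
rewrite generator_move // (count_memPn xs) addn0 binS bin1 exprD -!mulrA.
congr (_ * _); rewrite !mulrA -exprD addnn -signr_odd odd_double mul1r //.
Qed.

End Strings.

(** * Adjoints of rectangular matrices and unitarity *)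

Section Adjoint.
Variable C : numClosedFieldType.

(** Rectangular version of [adj], needed for the isometry between spaces of different dimensions; on
    square matrices the two are convertible. *)
Definition adjoint (p q : nat) (A : 'M[C]_(p, q)) : 'M[C]_(q, p) := (map_mx Num.conj A)^T.

Lemma adjointE p q (A : 'M[C]_(p, q)) i j : adjoint A i j = (A j i)^*.
Proof. by rewrite !mxE. Qed.

Lemma adjointK p q : cancel (@adjoint p q) (@adjoint q p).
Proof. by move=> A; apply/matrixP => i j; rewrite !mxE conjCK. Qed.

Lemma adjointM p q r (A : 'M[C]_(p, q)) (B : 'M[C]_(q, r)) :
  adjoint (A *m B) = adjoint B *m adjoint A.
Proof. by rewrite /adjoint map_mxM trmx_mul. Qed.

Lemma adjointD p q (A B : 'M[C]_(p, q)) : adjoint (A + B) = adjoint A + adjoint B.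
Proof. by rewrite /adjoint map_mxD linearD. Qed.

Lemma adjointB p q (A B : 'M[C]_(p, q)) : adjoint (A - B) = adjoint A - adjoint B.
Proof. by rewrite /adjoint map_mxB linearB. Qed.

Lemma adjointZ p q a (A : 'M[C]_(p, q)) : adjoint (a *: A) = a^* *: adjoint A.
Proof. by rewrite /adjoint map_mxZ linearZ. Qed.

Lemma adjoint_scalar p (a : C) : adjoint (a%:M : 'M_p) = (a^*)%:M.
Proof. by rewrite /adjoint map_scalar_mx tr_scalar_mx. Qed.

Lemma adjoint1 p : adjoint (1%:M : 'M_p) = 1%:M.
Proof. by rewrite adjoint_scalar conjC1. Qed.

Lemma trace_adjointM p q (A B : 'M[C]_(p, q)) :
  \tr (A *m adjoint B) = \sum_i \sum_j A i j * (B i j)^*.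
Proof.
by apply: eq_bigr => i _; rewrite mxE; apply: eq_bigr => j _; rewrite adjointE.
Qed.

(** The trace is the sum of the squared moduli of the entries. *)
Lemma trace_adjoint_eq0 p q (A : 'M[C]_(p, q)) : \tr (adjoint A *m A) = 0 -> A = 0.
Proof.
rewrite mxtrace_mulC trace_adjointM => /eqP; rewrite psumr_eq0 => [/allP H|i _].
  apply/matrixP => i j; have /eqP := H i (mem_index_enum i).
  move/eqP; rewrite psumr_eq0 => [/allP/(_ j (mem_index_enum j))|k _].
    by rewrite /= -normCK expf_eq0 normr_eq0 mxE => /eqP.
  by rewrite -normCK exprn_ge0.
by apply: sumr_ge0 => k _; rewrite -normCK exprn_ge0.
Qed.

Lemma unitaryP d (U : 'M[C]_d) : unitary U <-> adjoint U *m U = 1%:M.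
Proof. by split=> /mulmx1C. Qed.

Lemma unitaryM d (U V : 'M[C]_d) : unitary U -> unitary V -> unitary (U *m V).
Proof.
move=> hU hV; rewrite /unitary -[adj _]/(adjoint _) adjointM mulmxA -(mulmxA U).
by rewrite -[adjoint V]/(adj V) hV mulmx1.
Qed.

Lemma unitary1 d : unitary (1%:M : 'M[C]_d).
Proof. by rewrite /unitary -[adj _]/(adjoint _) adjoint1 mulmx1. Qed.

Lemma unitary_adjoint d (U : 'M[C]_d) : unitary U -> unitary (adjoint U).
Proof. by move=> hU; rewrite /unitary -[adj _]/(adjoint _) adjointK; apply/unitaryP. Qed.

(** Serves matrices that are square only up to a proved equality of dimensions. *)
Lemma mulmx1C_cast p q (e : p = q) (A : 'M[C]_(p, q)) (B : 'M[C]_(q, p)) :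
  A *m B = 1%:M -> B *m A = 1%:M.
Proof. by subst q; apply: mulmx1C. Qed.

Lemma natr_sqrt_exp2_neq0 (k d : nat) : (2 ^ k = d * d)%N -> (d%:R : C) != 0.
Proof. by case: d => [|d]; rewrite ?pnatr_eq0 // => /eqP; rewrite expn_eq0. Qed.

End Adjoint.

(** * Strings as an orthogonal matrix basis, and Schur's lemma *)

Section MatrixStrings.
Variables (C : numClosedFieldType) (I : finType) (d : nat) (f : I -> 'M[C]_d).
Hypothesis cf : clifford_family f.
Hypothesis fH : forall k, adjoint (f k) = f k.
Implicit Types (v w : {ffun I -> bool}).

Definition ordered_prod v : 'M[C]_d := \prod_(k | v k) f k.

(** The scalar is arbitrary, even zero: closure under products then needs no phase bookkeeping, and
    the zero matrix counts as a string. *)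
Definition is_string (M : 'M[C]_d) : Prop :=
  exists (l : C) v, M = l *: ordered_prod v.

Lemma ordered_prodE v : ordered_prod v = \prod_(k <- enum [pred k | v k]) f k.
Proof. by rewrite -deprecated_filter_index_enum big_filter. Qed.

Lemma is_string_prod (s : seq I) : is_string (\prod_(k <- s) f k).
Proof.
have [e ->] := prod_sort_sign s; last by [].
exists ((-1) ^+ e), [ffun k => odd (count_mem k s)].
rewrite -signr_odd mulr_sign -(signr_odd _ e) scaler_sign.
by rewrite /ordered_prod; under [in RHS]eq_bigl do rewrite ffunE.
Qed.

Lemma is_stringZ a M : is_string M -> is_string (a *: M).
Proof. by move=> [l [v ->]]; exists (a * l), v; rewrite scalerA. Qed.

Lemma is_stringM M N : is_string M -> is_string N -> is_string (M *m N).
Proof.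
move=> [l [v ->]] [k [w ->]]; rewrite -scalemxAl -scalemxAr; do 2!apply: is_stringZ.
by rewrite !ordered_prodE mulmxE -big_cat; apply: is_string_prod.
Qed.

Lemma is_string1 : is_string 1%:M.
Proof. by have := is_string_prod [::]; rewrite big_nil. Qed.

Lemma is_string_gen k : is_string (f k).
Proof. by have := is_string_prod [:: k]; rewrite big_seq1. Qed.

Lemma adjoint_prod (s : seq I) :
  adjoint (\prod_(k <- s) f k) = \prod_(k <- rev s) f k.
Proof.
elim: s => [|x s IH]; first by rewrite !big_nil -[1]/(1%:M) adjoint1.
rewrite big_cons -[f x * _]/(f x *m _) adjointM IH fH rev_cons -cats1 big_cat.
by rewrite big_seq1.
Qed.

Lemma unitary_prod (s : seq I) : unitary (\prod_(k <- s) f k).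
Proof.
elim: s => [|x s IH]; first by rewrite big_nil; apply: unitary1.
rewrite big_cons; apply: unitaryM => //.
by rewrite /unitary -[adj _]/(adjoint _) fH mulmxE cf.1.
Qed.

Lemma unitary_ordered_prod v : unitary (ordered_prod v).
Proof. by rewrite ordered_prodE; apply: unitary_prod. Qed.

Lemma generator_ordered_prod x v :
  f x *m ordered_prod v = (-1) ^+ (#|[pred k | v k]| + v x) *: (ordered_prod v *m f x).
Proof.
rewrite ordered_prodE mulmxE generator_move // count_uniq_mem ?enum_uniq //.
rewrite mem_enum -cardE -signr_odd mulr_sign -(signr_odd _ (_ + _)) scaler_sign.
by [].
Qed.

Hypothesis evenI : ~~ odd #|I|.

(** Some generator anticommutes with the product, so by cyclicity the trace equals its own
    negative. *)
Lemma trace_ordered_prod v w : v != w ->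
  \tr (ordered_prod v *m adjoint (ordered_prod w)) = 0.
Proof.
move=> nvw.
(* If all signs agreed, [v] and [w] would be equal or complementary. Complementary supports would
   have sizes of different parity, yet these sizes add up to the even number [#|I|]. *)
have [x Hx] : exists x, odd (#|[pred k | v k]| + v x) != odd (#|[pred k | w k]| + w x).
  apply/existsP; apply: contraR nvw; rewrite negb_exists => /forallP H.
  have {}H x : v x = w x (+) (odd #|[pred k | v k]| (+) odd #|[pred k | w k]|).
    have := H x; rewrite negbK !oddD !oddb => /eqP.
    by case: (v x) (w x) (odd _) (odd _) => [] [] [] [].
  apply/eqP/ffunP => x; rewrite H.
  case E: (odd #|[pred k | v k]| (+) odd #|[pred k | w k]|); last by rewrite addbF.
  have : #|[pred k | v k]| + #|[pred k | w k]| = #|I|.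
    rewrite -(cardC [pred k | w k]) addnC; congr (_ + _)%N; apply: eq_card => y.
    by rewrite !inE [LHS]H E addbT.
  by move/(congr1 odd); rewrite oddD E (negPf evenI).
set M := _ *m _.
have MM : f x *m M = - (M *m f x).
  rewrite /M mulmxA generator_ordered_prod -scalemxAl -mulmxA.
  have : f x *m adjoint (ordered_prod w) =
     (-1) ^+ (#|[pred k | w k]| + w x) *: (adjoint (ordered_prod w) *m f x).
    have /(congr1 (@adjoint C d d)) := generator_ordered_prod x w.
    rewrite adjointZ !adjointM fH => ->.
    rewrite scalerA rmorphXn rmorphN1 -exprMn mulrNN mulr1 expr1n scale1r //.
  move->; rewrite -scalemxAr scalerA mulmxA -exprD -signr_odd.
  rewrite oddD (_ : _ (+) _ = true) ?scaleN1r //.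
  by move: Hx; case: (odd _) (odd _) => [] [].
have : \tr M = - \tr M.
  have {1}-> : M = f x *m (f x *m M) by rewrite mulmxA mulmxE cf.1 mul1r.
  by rewrite mxtrace_mulC MM mulNmx -mulmxA mulmxE cf.1 mulr1 raddfN.
by move/eqP; rewrite -subr_eq0 opprK -mulr2n mulrn_eq0 /= => /eqP.
Qed.

Hypothesis dimI : (2 ^ #|I| = d * d)%N.

(** The vectorized strings are orthogonal rows, and there are exactly [d * d] of them. Up to scale
    they form a unitary matrix, whose columns are therefore orthogonal too. *)
Lemma ordered_prod_complete a b a' b' :
  \sum_v ordered_prod v a b * (ordered_prod v a' b')^* =
  d%:R * ((a == a') && (b == b'))%:R.
Proof.
have d0 := natr_sqrt_exp2_neq0 C dimI.
pose K := {ffun I -> bool}.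
pose R : 'M[C]_(#|K|, d * d) := \matrix_(i, j) mxvec (ordered_prod (enum_val i)) 0 j.
have RR : R *m (d%:R^-1 *: adjoint R) = 1%:M.
  rewrite -scalemxAr; apply/matrixP => i j; rewrite !mxE.
  transitivity (d%:R^-1 * \tr (ordered_prod (enum_val i) *m adjoint (ordered_prod (enum_val j)))).
    congr (_ * _); rewrite trace_adjointM pair_big /=.
    rewrite (reindex _ (curry_mxvec_bij _ _)) /=; apply: eq_bigr => [[x y]] _ /=.
    by rewrite adjointE !mxE !mxvecE.
  have [<-|nij] := eqVneq i j.
    have : unitary (ordered_prod (enum_val i)) := unitary_ordered_prod _.
    by rewrite /unitary -[adj _]/(adjoint _) => ->; rewrite mxtrace1 mulVf.
  by rewrite trace_ordered_prod ?mulr0 // (inj_eq enum_val_inj).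
have cK : #|K| = (d * d)%N by rewrite card_ffun card_bool.
have /matrixP/(_ (mxvec_index a' b') (mxvec_index a b)) := mulmx1C_cast cK RR.
rewrite -scalemxAl mxE [in RHS]mxE => /(congr1 ( *%R d%:R)).
rewrite mulrA mulfV // mul1r mxE => E.
have idxE : (mxvec_index a' b' == mxvec_index a b) = ((a == a') && (b == b')).
  case: (curry_mxvec_bij d d) => g gK _.
  have inj : injective (uncurry (@mxvec_index d d)) by apply: can_inj (fun x => gK x isT).
  have := inj_eq inj (a', b') (a, b).
  by rewrite /= xpair_eqE (eq_sym a) (eq_sym b).
rewrite idxE in E; rewrite -E.
rewrite (reindex (@enum_val K predT)) /=; last exact: onW_bij (enum_val_bij _).
by apply: eq_bigr => i _; rewrite adjointE !mxE !mxvecE mulrC.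
Qed.

(** This is the completeness relation contracted with the entries of [A]. *)
Lemma twirl (A : 'M[C]_d) :
  \sum_v ordered_prod v *m A *m adjoint (ordered_prod v) = (d%:R * \tr A)%:M.
Proof.
apply/matrixP => a a'; rewrite summxE mxE.
transitivity (\sum_b \sum_b' A b b' *
    \sum_v ordered_prod v a b * (ordered_prod v a' b')^*).
  under eq_bigr => v _.
    rewrite mxE; under eq_bigr => b' _ do rewrite mxE adjointE mulr_suml.
    rewrite exchange_big; over.
  rewrite exchange_big; apply: eq_bigr => b _; rewrite exchange_big.
  apply: eq_bigr => b' _; rewrite mulr_sumr; apply: eq_bigr => v _.
  by rewrite (mulrC (ordered_prod v a b)) mulrA.
under eq_bigr => b _.
  under eq_bigr => b' _ do rewrite ordered_prod_complete.
  rewrite (bigD1 b) //= big1 => [|b' nb]; last by rewrite (eq_sym b) (negPf nb) andbF !mulr0.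
  rewrite eqxx andbT addr0 mulrA (mulrC _ d%:R); over.
by rewrite -mulr_suml -mulr_sumr mulr_natr.
Qed.

(** Schur's lemma: if [A] commutes with the generators, every term of the twirl equals [A], while
    the sum is scalar. *)
Lemma commute_scalar (A : 'M[C]_d) : (forall k, f k *m A = A *m f k) ->
  A = (d%:R^-1 * \tr A)%:M.
Proof.
move=> cA; have d0 := natr_sqrt_exp2_neq0 C dimI.
have cp v : ordered_prod v *m A = A *m ordered_prod v.
  rewrite ordered_prodE; elim: (enum _) => [|x s IH].
    by rewrite big_nil mulmxE mul1r mulr1.
  by rewrite big_cons -[f x * _]/(f x *m _) -mulmxA IH !mulmxA cA.
have := twirl A.
under eq_bigr => v _ do
  rewrite cp -mulmxA [ordered_prod v *m _](unitary_ordered_prod v) mulmx1.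
rewrite sumr_const card_ffun card_bool dimI => H.
have : (d * d)%:R *: A = (d%:R * \tr A)%:M by rewrite -H scaler_nat.
move/(congr1 ( *:%R (d * d)%:R^-1)); rewrite scalerA mulVf ?natrM ?mulf_neq0 //.
rewrite scale1r => {1}->; rewrite scale_scalar_mx; congr (_%:M).
by rewrite invfM mulrA mulfVK.
Qed.

End MatrixStrings.

(** * An isometry intertwining two families *)

Section Intertwiner.
Variables (C : numClosedFieldType) (I : finType) (D d : nat).
Variables (f : I -> 'M[C]_D) (g : I -> 'M[C]_d) (P : 'M[C]_D).
Hypotheses (cf : clifford_family f) (cg : clifford_family g).
Hypotheses (fH : forall k, adjoint (f k) = f k) (gH : forall k, adjoint (g k) = g k).
Hypotheses (evenI : ~~ odd #|I|) (dimI : (2 ^ #|I| = d * d)%N).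
Hypotheses (PP : P *m P = P) (PH : adjoint P = P) (trP : \tr P = d%:R).
Hypothesis cP : forall k, f k *m P = P *m f k.

Let d_neq0 := natr_sqrt_exp2_neq0 C dimI.

(** Multiplication by generator [k] toggles [k] in the support of a string, up to sign. *)
Definition flip (k : I) (v : {ffun I -> bool}) : {ffun I -> bool} :=
  [ffun j => (k == j) (+) v j].

Lemma flipK k : involutive (flip k).
Proof. by move=> v; apply/ffunP => j; rewrite !ffunE addKb. Qed.

Lemma flip_sign k (v : {ffun I -> bool}) :
  exists e : nat, forall (R : pzRingType) (h : I -> R), clifford_family h ->
    h k * \prod_(j | v j) h j = (-1) ^+ e * \prod_(j | flip k v j) h j.
Proof.
have [e He] := prod_sort_sign (k :: enum [pred j | v j]); exists e => R h ch.
have := He R h ch; rewrite big_cons -deprecated_filter_index_enum big_filter => ->.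
congr (_ * _); apply: eq_bigl => j; rewrite deprecated_filter_index_enum ffunE /=.
by rewrite count_uniq_mem ?enum_uniq // mem_enum inE oddD !oddb.
Qed.

Definition average (X : 'M[C]_(D, d)) : 'M[C]_(D, d) :=
  \sum_v ordered_prod f v *m X *m adjoint (ordered_prod g v).

(** Conjugation by generator [k] permutes the terms: both families pick up the same sign under
    [flip k], and the two signs cancel. *)
Lemma average_intertwines k X : f k *m average X = average X *m g k.
Proof.
have gk1 : g k *m g k = 1%:M by rewrite mulmxE cg.1.
suff {2}<- : f k *m average X *m g k = average X by rewrite -mulmxA gk1 mulmx1.
rewrite /average mulmx_sumr mulmx_suml [RHS](reindex_inj (inv_inj (flipK k))).
apply: eq_bigr => v _; have [e He] := flip_sign k v.
have Ef : f k *m ordered_prod f v = (-1) ^+ e *: ordered_prod f (flip k v).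
  by rewrite mulmxE He // -signr_odd mulr_sign -(signr_odd _ e) scaler_sign.
have Eg : adjoint (ordered_prod g v) *m g k = (-1) ^+ e *: adjoint (ordered_prod g (flip k v)).
  rewrite -{1}(gH k) -adjointM mulmxE He //.
  rewrite -[in LHS]signr_odd mulr_sign -[in RHS]signr_odd scaler_sign.
  by case: ifP => // _; rewrite /adjoint map_mxN linearN.
rewrite !mulmxA Ef -mulmxA Eg -!scalemxAl -scalemxAr scalerA -exprMn mulrNN mulr1.
by rewrite expr1n scale1r.
Qed.

(** [P] commutes with every string of [f], so averaging stays inside the image of [P]. *)
Lemma average_proj X : P *m average (P *m X) = average (P *m X).
Proof.
rewrite /average mulmx_sumr; apply: eq_bigr => v _.
have cp : P *m ordered_prod f v = ordered_prod f v *m P.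
  rewrite ordered_prodE; elim: (enum _) => [|x s IH].
    by rewrite big_nil mulmxE mul1r mulr1.
  by rewrite big_cons -[f x * _]/(f x *m _) mulmxA -cP -mulmxA IH mulmxA.
by rewrite !mulmxA cp -(mulmxA _ P P) PP.
Qed.

(* Summing the (a, j) entries of the averages of P E_ij over j pairs each string
   of f with the trace of the same string of g, which isolates the empty string. *)
Lemma average_neq0 : exists i j, average (P *m delta_mx i j) != 0.
Proof.
case: (classic (exists i j, average (P *m delta_mx i j) != 0)) => // H.
have H0 i j : average (P *m delta_mx i j) = 0.
  by apply/eqP; apply/negP => /negP ?; apply: H; exists i, j.
suff P0 : P = 0 by move: trP; rewrite P0 mxtrace0 => /eqP; rewrite eq_sym (negPf d_neq0).
apply/matrixP => a i; rewrite mxE.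
have : \sum_j average (P *m delta_mx i j) a j = 0.
  by rewrite big1 // => j _; rewrite H0 mxE.
have E v j : (ordered_prod f v *m (P *m delta_mx i j) *m adjoint (ordered_prod g v)) a j =
    (ordered_prod f v *m P) a i * (ordered_prod g v j j)^*.
  rewrite mulmxA mxE (bigD1 j) //= big1 => [|b nb].
    rewrite addr0 adjointE; congr (_ * _); rewrite mxE (bigD1 i) //= big1 => [|b nb].
      by rewrite [delta_mx _ _ _ _]mxE !eqxx mulr1 addr0.
    by rewrite [delta_mx _ _ _ _]mxE (negPf nb) mulr0.
  rewrite [X in X * _]mxE big1 ?mul0r // => c _.
  by rewrite [delta_mx _ _ _ _]mxE (negPf nb) andbF mulr0.
under eq_bigr => j _.
  rewrite summxE; under eq_bigr => v _ do rewrite E.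
  over.
rewrite exchange_big /=.
under eq_bigr => v _ do rewrite -mulr_sumr -rmorph_sum /=.
pose v0 : {ffun I -> bool} := [ffun => false].
have p0 (p : nat) (h : I -> 'M[C]_p) : ordered_prod h v0 = 1%:M.
  by rewrite /ordered_prod big_pred0 // => k; rewrite ffunE.
rewrite (bigD1 v0) //= [X in _ + X]big1 => [|v nv].
  rewrite !p0 mul1mx addr0 -[\sum_i _]/(\tr 1%:M) mxtrace1 conjC_nat => /eqP.
  by rewrite mulf_eq0 (negPf d_neq0) orbF => /eqP.
have := trace_ordered_prod cg gH evenI nv.
by rewrite p0 adjoint1 mulmx1 /mxtrace => ->; rewrite conjC0 mulr0.
Qed.

(** For a nonzero average [T], the product [adjoint T *m T] commutes with [g], hence is a positive
    scalar [c]; dividing [T] by the square root of [c] gives the isometry. *)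
Lemma isometric_intertwiner : exists W : 'M[C]_(D, d),
  [/\ adjoint W *m W = 1%:M, W *m adjoint W = P & forall k, f k *m W = W *m g k].
Proof.
have [i [j]] := average_neq0.
have := average_proj (delta_mx i j).
have := average_intertwines^~ (P *m delta_mx i j).
move: (average _) => T fT PT T0.
set c := d%:R^-1 * \tr (adjoint T *m T).
have TT : adjoint T *m T = c%:M.
  apply: (commute_scalar cg gH evenI dimI) => k.
  rewrite -mulmxA -fT mulmxA -{1}(gH k) -adjointM -fT adjointM fH.
  by rewrite !mulmxA.
have c0 : 0 < c.
  rewrite lt_def; apply/andP; split.
    apply: contra T0 => /eqP c0; apply/eqP/trace_adjoint_eq0.
    by rewrite TT c0 -scalemx1 scale0r mxtrace0.
  rewrite mulr_ge0 ?invr_ge0 ?ler0n // mxtrace_mulC trace_adjointM.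
  by do 2!apply: sumr_ge0 => ? _; rewrite -normCK exprn_ge0.
set r := (sqrtC c)^-1.
have rr : r^* * r * c = 1.
  have r0 : 0 <= r by rewrite invr_ge0 sqrtC_ge0 ltW.
  by rewrite (CrealP (ger0_real r0)) -expr2 exprVn sqrtCK mulVf // gt_eqF.
pose W := r *: T.
have WW : adjoint W *m W = 1%:M.
  by rewrite adjointZ -scalemxAl -scalemxAr scalerA TT scale_scalar_mx rr.
have PW : P *m W = W by rewrite -scalemxAr PT.
exists W; split=> [//||k]; last by rewrite -scalemxAr -scalemxAl fT.
(* Since [P *m W = W], the difference [P - W *m adjoint W] is a projection; its trace is
   [d - d = 0], so it vanishes. *)
apply/eqP; rewrite eq_sym -subr_eq0; apply/eqP/trace_adjoint_eq0.
have WP : adjoint W *m P = adjoint W by rewrite -{1}PH -adjointM PW.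
rewrite adjointB PH adjointM adjointK mulmxBl !mulmxBr PP mulmxA PW.
rewrite -(mulmxA W _ P) WP -(mulmxA W) (mulmxA _ W) WW mul1mx subrr subr0.
by rewrite raddfB /= mxtrace_mulC WW mxtrace1 trP subrr.
Qed.

End Intertwiner.

(** * Transversals modulo phase, and means over groups *)

Section Transversals.
Variable C : numClosedFieldType.

Lemma phase_eq_refl d (A : 'M[C]_d) : phase_eq A A.
Proof. by exists 1; rewrite normr1 scale1r. Qed.

Lemma phase_eq_sym d (A B : 'M[C]_d) : phase_eq A B -> phase_eq B A.
Proof.
move=> [l [nl ->]]; exists l^-1; rewrite normfV nl invr1 scalerA mulVf ?scale1r //.
by rewrite -normr_gt0 nl.
Qed.

Lemma phase_eq_trans d (A B D : 'M[C]_d) : phase_eq A B -> phase_eq B D -> phase_eq A D.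
Proof.
by move=> [l [nl ->]] [k [nk ->]]; exists (l * k); rewrite normrM nl nk mulr1 scalerA.
Qed.

Lemma phase_eq_mull d (M A B : 'M[C]_d) : phase_eq A B -> phase_eq (M *m A) (M *m B).
Proof. by move=> [l [nl ->]]; exists l; rewrite -scalemxAr. Qed.

Lemma phase_eq_mulr d (M A B : 'M[C]_d) : phase_eq A B -> phase_eq (A *m M) (B *m M).
Proof. by move=> [l [nl ->]]; exists l; rewrite -scalemxAl. Qed.

(** [D] attaches keys from a finite type, and a shared key forces equality up to phase, so at most
    one member per key has to be kept. *)
Lemma transversal_exists d (G : 'M[C]_d -> Prop) (K : finType) (D : 'M[C]_d -> K -> Prop) :
  (forall g, G g -> exists k, D g k) ->
  (forall g h k, G g -> G h -> D g k -> D h k -> phase_eq g h) ->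
  exists s, Defs.transversal G s.
Proof.
move=> exD injD.
have [s [sG sD sI]] : exists s : seq 'M[C]_d, [/\ forall U, U \in s -> G U,
    forall g k, G g -> D g k -> k \in enum K -> exists2 U, U \in s & phase_eq g U &
    forall i j, (i < size s)%N -> (j < size s)%N ->
        phase_eq (nth 0 s i) (nth 0 s j) -> i = j].
  (* A member with key [k] is added only when its phase class is not yet represented. *)
  elim: (enum K) => [|k e [s [sG sD sI]]]; first by exists [::].
  have [[h [Gh Dh nh]]|nh] := classic (exists h, [/\ G h, D h k &
      ~ exists2 U, U \in s & phase_eq h U]).
    exists (h :: s); split=> [U|g k' Gg Dg|].
    - by rewrite inE => /predU1P[->|/sG].
    - rewrite inE => /predU1P[E|/(sD g k' Gg Dg)[U sU gU]]; last first.
        by exists U => //; rewrite inE sU orbT.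
      by exists h; rewrite ?mem_head //; apply: (injD _ _ k) => //; rewrite -E.
    - move=> [|i] [|j] //=; rewrite !ltnS => li lj.
      + by move=> E; case: nh; exists s`_j; rewrite ?mem_nth.
      + by move=> /phase_eq_sym E; case: nh; exists s`_i; rewrite ?mem_nth.
      + by move=> /(sI _ _ li lj) ->.
  exists s; split=> // g k' Gg Dg; rewrite inE => /predU1P[E|/(sD g k' Gg Dg)//].
  by apply: NNPP => ng; apply: nh; exists g; split; rewrite -?E.
exists s; split=> // g Gg; have [k Dk] := exD g Gg.
by apply: sD Gg Dk _; rewrite mem_enum.
Qed.

Lemma transversal_uniq d (G : 'M[C]_d -> Prop) s : Defs.transversal G s -> uniq s.
Proof.
move=> [_ _ sI]; apply/(uniqP 0) => i j; rewrite !inE => li lj E.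
by apply: sI => //; rewrite E; apply: phase_eq_refl.
Qed.

Lemma transversal_inj d (G : 'M[C]_d -> Prop) s U V : Defs.transversal G s ->
  U \in s -> V \in s -> phase_eq U V -> U = V.
Proof.
move=> [_ _ sI] sU sV; rewrite -{1}(nth_index 0 sU) -{1}(nth_index 0 sV).
move/sI; rewrite !index_mem => /(_ sU sV) E.
by rewrite -(nth_index 0 sU) E nth_index.
Qed.

(** Sending each element of [s] to its representative in [s'] is a bijection that changes only
    phases. *)
Lemma transversal_sum d (G : 'M[C]_d -> Prop) s s' (H : 'M[C]_d -> C) :
  Defs.transversal G s -> Defs.transversal G s' -> (forall A B, phase_eq A B -> H A = H B) ->
  \sum_(U <- s) H U = \sum_(U <- s') H U.
Proof.
move=> ts ts' HP; have [sG sR _] := ts; have [sG' sR' _] := ts'.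
pose r U := epsilon (inhabits 0) (fun V => V \in s' /\ phase_eq U V).
have rP U : U \in s -> r U \in s' /\ phase_eq U (r U).
  move=> /sG/sR'[V sV UV]; apply: (epsilon_spec (inhabits 0) (fun V => V \in s' /\ phase_eq U V)).
  by exists V.
have pe : perm_eq (map r s) s'.
  apply: uniq_perm; rewrite ?(transversal_uniq ts') //.
    rewrite map_inj_in_uniq ?(transversal_uniq ts) // => U V sU sV E.
    apply: (transversal_inj ts) => //; apply: phase_eq_trans (rP U sU).2 _.
    by rewrite E; apply: phase_eq_sym (rP V sV).2.
  move=> V; apply/mapP/idP => [[U sU ->]|sV]; first exact: (rP U sU).1.
  have [U sU VU] := sR _ (sG' _ sV); exists U => //.
  by apply: (transversal_inj ts') => //; [exact: (rP U sU).1|apply: phase_eq_trans VU (rP U sU).2].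
by rewrite -(perm_big _ pe) big_map; apply: eq_big_seq => U sU; apply: HP (rP U sU).2.
Qed.

Definition unitary_group d (G : 'M[C]_d -> Prop) : Prop :=
  [/\ G 1%:M, forall g, G g -> unitary g, forall g h, G g -> G h -> G (g *m h)
    & forall g, G g -> G (adjoint g)].

Lemma transversal_mull d (G : 'M[C]_d -> Prop) s g : unitary_group G ->
  Defs.transversal G s -> G g -> Defs.transversal G [seq g *m U | U <- s].
Proof.
move=> [_ uG mG vG] [sG sR sI] Gg; split=> [_ /mapP[U /sG GU ->]|h Gh|i j].
- exact: mG.
- have [U sU hU] := sR _ (mG _ _ (vG _ Gg) Gh).
  exists (g *m U); first exact: map_f.
  by have := phase_eq_mull g hU; rewrite mulmxA [g *m _](uG _ Gg) mul1mx.
- rewrite size_map => li lj; rewrite !(nth_map 0) // => /(phase_eq_mull (adjoint g)).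
  by rewrite !mulmxA ((unitaryP _).1 (uG _ Gg)) !mul1mx; apply: sI.
Qed.

Lemma transversal_mulr d (G : 'M[C]_d -> Prop) s g : unitary_group G ->
  Defs.transversal G s -> G g -> Defs.transversal G [seq U *m g | U <- s].
Proof.
move=> [_ uG mG vG] [sG sR sI] Gg; split=> [_ /mapP[U /sG GU ->]|h Gh|i j].
- exact: mG.
- have [U sU hU] := sR _ (mG _ _ Gh (vG _ Gg)).
  exists (U *m g); first exact: map_f.
  by have := phase_eq_mulr g hU; rewrite -mulmxA ((unitaryP _).1 (uG _ Gg)) mulmx1.
- rewrite size_map => li lj; rewrite !(nth_map 0) // => /(phase_eq_mulr (adjoint g)).
  by rewrite -!mulmxA [g *m _](uG _ Gg) !mulmx1; apply: sI.
Qed.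

Lemma size_transversal_neq0 d (G : 'M[C]_d -> Prop) s : unitary_group G ->
  Defs.transversal G s -> ((size s)%:R : C) != 0.
Proof.
by move=> [G1 _ _ _] [_ /(_ _ G1)[U sU _] _]; rewrite pnatr_eq0; case: s sU.
Qed.

Variables (D d : nat) (G : 'M[C]_D -> Prop) (G' : 'M[C]_d -> Prop).
Variable phi : 'M[C]_D -> 'M[C]_d.
Hypotheses (gG : unitary_group G) (gG' : unitary_group G').
Hypothesis phiG : forall g, G g -> G' (phi g).
Hypothesis phiM : forall g h, G g -> G h -> phi (g *m h) = phi g *m phi h.
Hypothesis phiZ : forall l g, phi (l *: g) = l *: phi g.
Hypothesis phi_onto : forall h, G' h -> exists2 g, G g & phi g = h.

(** The double sum of [H (h *m phi U)] over [h] in [s'] and [U] in [s] is evaluated in both orders: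
    [h] has a preimage, which merely translates [s], and [phi U] merely translates [s']. This takes
    the place of an explicit count of fibres. *)
Lemma transversal_mean s s' (H : 'M[C]_d -> C) :
  Defs.transversal G s -> Defs.transversal G' s' -> (forall A B, phase_eq A B -> H A = H B) ->
  (size s)%:R^-1 * \sum_(U <- s) H (phi U) = (size s')%:R^-1 * \sum_(V <- s') H V.
Proof.
move=> ts ts' HP.
have nz := size_transversal_neq0 gG ts; have nz' := size_transversal_neq0 gG' ts'.
have inv h : G' h -> \sum_(U <- s) H (h *m phi U) = \sum_(U <- s) H (phi U).
  move=> /phi_onto[g Gg <-].
  have HPphi A B : phase_eq A B -> H (phi A) = H (phi B).
    by move=> [l [nl ->]]; apply: HP; exists l; rewrite phiZ.
  rewrite (transversal_sum (H := H \o phi) ts (transversal_mull gG ts Gg) HPphi) big_map.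
  by apply: eq_big_seq => U sU /=; rewrite phiM //; case: ts => /(_ U sU).
have E : (size s')%:R * \sum_(U <- s) H (phi U) = (size s)%:R * \sum_(V <- s') H V.
  transitivity (\sum_(h <- s') \sum_(U <- s) H (h *m phi U)).
    rewrite [RHS](eq_big_seq (fun=> \sum_(U <- s) H (phi U))) => [|h sh].
      by rewrite big_const_seq count_predT iter_addr_0 mulr_natl.
    by apply: inv; case: ts' => /(_ h sh).
  rewrite exchange_big /=.
  rewrite (eq_big_seq (fun=> \sum_(V <- s') H V)) => [|U sU].
    by rewrite big_const_seq count_predT iter_addr_0 mulr_natl.
  have GU : G' (phi U) by apply: phiG; case: ts => /(_ U sU).
  rewrite -(transversal_sum (transversal_mulr gG' ts' GU) ts' HP).
  by rewrite big_map.
apply: (mulfI nz); apply: (mulfI nz').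
by rewrite mulVKf // E mulrCA mulVKf.
Qed.

End Transversals.

(** * The normalizer of the strings and its finiteness modulo phase *)

Section Normalizer.
Variables (C : numClosedFieldType) (I : finType) (d : nat) (f : I -> 'M[C]_d).
Hypothesis cf : clifford_family f.
Hypothesis fH : forall k, adjoint (f k) = f k.
Hypothesis evenI : ~~ odd #|I|.
Hypothesis dimI : (2 ^ #|I| = d * d)%N.
Implicit Types (v w : {ffun I -> bool}) (g h : 'M[C]_d).

(** Only generators are tested and no phases are recorded; [CliffordP] identifies this with the
    Clifford group. *)
Definition string_normalizer g : Prop :=
  unitary g /\ forall k, is_string f (g *m f k *m adjoint g).

Let dim_neq0 := natr_sqrt_exp2_neq0 C dimI.

Lemma scalar_inj (a b : C) : a%:M = b%:M :> 'M_d -> a = b.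
Proof.
move/(congr1 mxtrace); rewrite !mxtrace_scalar -(mulr_natr a) -(mulr_natr b).
exact: (mulIf dim_neq0).
Qed.

Lemma conj_string g M : string_normalizer g -> is_string f M ->
  is_string f (g *m M *m adjoint g).
Proof.
move=> [ug sg] [l [v ->]]; rewrite -scalemxAr -scalemxAl; apply: is_stringZ.
rewrite ordered_prodE; elim: (enum _) => [|x s IH].
  rewrite big_nil -[1]/(1%:M) mulmx1 [g *m _]ug; exact: is_string1.
rewrite big_cons -[f x * _]/(f x *m _).
have := is_stringM cf (sg x) IH.
by rewrite !mulmxA -(mulmxA _ (adjoint g) g) ((unitaryP _).1 ug) mulmx1.
Qed.

(** The scalar cannot vanish because the conjugate is unitary. *)
Lemma conj_ordered_prod g v : string_normalizer g ->
  exists l w, l != 0 /\ g *m ordered_prod f v *m adjoint g = l *: ordered_prod f w.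
Proof.
move=> ng; have sv : is_string f (ordered_prod f v) by exists 1, v; rewrite scale1r.
have [l [w E]] := conj_string ng sv; exists l, w; split=> //; apply/eqP => l0.
have : unitary (g *m ordered_prod f v *m adjoint g).
  apply: unitaryM (unitary_adjoint ng.1).
  exact: unitaryM ng.1 (unitary_ordered_prod cf fH v).
rewrite /unitary E l0 scale0r mul0mx => /esym.
rewrite -[1%:M]scalemx1 scale1r -(scale0r (1%:M : 'M[C]_d)) scalemx1.
by move/scalar_inj/eqP; rewrite oner_eq0.
Qed.

(** Strings with different supports are orthogonal, hence never proportional. *)
Lemma ordered_prod_inj l v w : ordered_prod f v = l *: ordered_prod f w -> v = w.
Proof.
move=> E; apply/eqP; apply/negPn/negP => /(trace_ordered_prod cf fH evenI).
rewrite {1}E -scalemxAl linearZ /= [X in \tr X](unitary_ordered_prod cf fH w) mxtrace1.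
move/eqP; rewrite mulf_eq0 (negPf dim_neq0) orbF => /eqP l0.
have := unitary_ordered_prod cf fH v; rewrite /unitary E l0 scale0r mul0mx.
move/(congr1 mxtrace)/esym/eqP; rewrite mxtrace1 mxtrace0; exact/negP/dim_neq0.
Qed.

Lemma string_normalizer_group : unitary_group string_normalizer.
Proof.
split=> [||g h ng nh|g ng]; last 1 first.
- have ag := (unitaryP _).1 ng.1.
  have [l Hl] := fin_all_exists (fun v => conj_ordered_prod v ng).
  have [S HS] := fin_all_exists Hl.
  (* Closure under adjoints: [S] is an injective self-map of a finite set, so every generator is, up
     to a scalar, the conjugate of some string, and conjugating back yields that string. *)
  have S_inj : injective S.
    move=> v w E; have [lv Ev] := HS v; have [lw Ew] := HS w.
    apply: (@ordered_prod_inj (l v / l w)).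
    have : g *m ordered_prod f v *m adjoint g =
           (l v / l w) *: (g *m ordered_prod f w *m adjoint g).
      by rewrite Ev Ew E scalerA mulfVK.
    move/(congr1 (fun X => adjoint g *m X *m g)).
    rewrite -scalemxAr -scalemxAl !mulmxA !ag !mul1mx.
    by rewrite -!(mulmxA _ (adjoint g) g) ag !mulmx1.
  split=> [|k]; first exact: unitary_adjoint ng.1.
  pose w : {ffun I -> bool} := [ffun j => j == k].
  have wk : ordered_prod f w = f k.
    by rewrite /ordered_prod (big_pred1 k) // => j; rewrite ffunE.
  have [lv Ev] := HS (invF S_inj w); rewrite f_invF wk in Ev.
  exists (l (invF S_inj w))^-1, (invF S_inj w).
  have -> : f k = (l (invF S_inj w))^-1 *: (g *m ordered_prod f (invF S_inj w) *m adjoint g).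
    by rewrite Ev scalerA mulVf // scale1r.
  rewrite -scalemxAr -scalemxAl adjointK !mulmxA ag mul1mx.
  by rewrite -mulmxA ag mulmx1.
- split=> [|k]; first exact: unitary1.
  by rewrite mul1mx adjoint1 mulmx1; apply: is_string_gen.
- by move=> g [].
split=> [|k]; first exact: unitaryM ng.1 nh.1.
by rewrite adjointM; have := conj_string ng (nh.2 k); rewrite !mulmxA.
Qed.

Lemma root4_unity (l : C) : l ^+ 4 = 1 -> exists j : 'I_4, l = 'i ^+ j.
Proof.
move=> l4; have : (l - 1) * (l + 1) * ((l - 'i) * (l + 'i)) = 0.
  by rewrite -!subr_sqr sqrCi expr1n opprK -subr_sqr expr1n -exprM l4 subrr.
move/eqP; rewrite !mulf_eq0 !subr_eq0 !addr_eq0 => /orP[/orP[]|/orP[]] /eqP ->.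
- by exists (Ordinal (isT : 0 < 4)%N).
- by exists (Ordinal (isT : 2 < 4)%N); rewrite /= sqrCi.
- by exists (Ordinal (isT : 1 < 4)%N).
- by exists (Ordinal (isT : 3 < 4)%N); rewrite /= exprS sqrCi mulrN1.
Qed.

(** Reversal changes a word only by a sign, so a string is its own adjoint up to sign and, being
    unitary, squares to a sign; hence so does [l]. *)
Lemma involutive_string M l w : M *m M = 1%:M -> M = l *: ordered_prod f w -> l ^+ 4 = 1.
Proof.
move=> MM Mlw.
have [e pp] : exists e : nat, ordered_prod f w *m ordered_prod f w = ((-1) ^+ e)%:M.
  pose e := 'C(size (enum [pred k | w k]), 2); exists e.
  have E : adjoint (ordered_prod f w) = (-1) ^+ e *: ordered_prod f w.
    rewrite ordered_prodE adjoint_prod // prod_rev_sign ?enum_uniq // -/e.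
    by rewrite -(signr_odd _ e) mulr_sign -(signr_odd _ e) scaler_sign.
  have := unitary_ordered_prod cf fH w; rewrite /unitary -[adj _]/(adjoint _) E.
  rewrite -scalemxAr => /(congr1 ( *:%R ((-1) ^+ e))).
  by rewrite scalerA -exprMn mulrNN mulr1 expr1n scale1r scalemx1.
move: MM; rewrite Mlw -scalemxAl -scalemxAr scalerA pp scale_scalar_mx => /scalar_inj E.
have : (l * l * (-1) ^+ e) ^+ 2 = 1 by rewrite E expr1n.
by rewrite exprMn -exprM mulnC exprM sqrrN expr1n expr1n mulr1 -expr2 -exprM.
Qed.

(** The key of an element lists the images of the generators. Each image is an involution, so its
    phase is a power of ['i], and only finitely many keys exist. *)
Lemma subgroup_transversal_exists (G : 'M[C]_d -> Prop) :
  (forall g, G g -> string_normalizer g) -> exists s, Defs.transversal G s.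
Proof.
move=> GN.
pose K : finType := {ffun I -> 'I_4 * {ffun I -> bool}}.
apply: (@transversal_exists C d G K (fun g (key : K) => forall x,
   g *m f x *m adjoint g = 'i ^+ (key x).1 *: ordered_prod f (key x).2)).
  move=> g /GN[ug sg].
  have ex x : exists k : 'I_4 * {ffun I -> bool},
     g *m f x *m adjoint g = 'i ^+ k.1 *: ordered_prod f k.2.
    have [l [w E]] := sg x.
    have /involutive_string/(_ E)/root4_unity[j lj] :
       (g *m f x *m adjoint g) *m (g *m f x *m adjoint g) = 1%:M.
      rewrite !mulmxA -(mulmxA _ (adjoint g) g) ((unitaryP _).1 ug) mulmx1.
      by rewrite -(mulmxA g) mulmxE cf.1 mulr1 -mulmxE; apply: ug.
    by exists (j, w); rewrite E lj.
  have [k Hk] := fin_all_exists ex; exists [ffun x => k x] => x.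
  by rewrite ffunE.
move=> g h k /GN[ug _] /GN[uh _] Dg Dh.
have ah := (unitaryP _).1 uh; have ag := (unitaryP _).1 ug.
(* Two elements with the same key differ by a matrix commuting with all generators, which is scalar
   by Schur's lemma. *)
have cM x : f x *m (adjoint h *m g) = (adjoint h *m g) *m f x.
  have : h *m f x *m adjoint h = g *m f x *m adjoint g by rewrite Dg Dh.
  move/(congr1 (fun X => adjoint h *m X *m g)).
  rewrite !mulmxA ah mul1mx -(mulmxA _ (adjoint g) g) ag mulmx1 => ->.
  by [].
have := commute_scalar cf fH evenI dimI cM; set a := _ * \tr _ => E.
have gah : g = a *: h.
  have : h *m (adjoint h *m g) = h *m a%:M by rewrite E.
  by rewrite mulmxA [h *m _]uh mul1mx mul_mx_scalar.
exists a; split=> //; move: ug; rewrite /unitary gah -[adj _]/(adjoint _) adjointZ.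
rewrite -scalemxAl -scalemxAr [h *m _]uh scalerA scalemx1 => /scalar_inj E1.
by apply/eqP; rewrite -sqrp_eq1 ?normr_ge0 // normCK E1.
Qed.

End Normalizer.

(** * The Majorana Clifford group as a string normalizer *)

Section CliffordGroup.
Variables (C : numClosedFieldType) (m : nat) (chi : 'I_(2 * m) -> 'M[C]_(2 ^ m)).
Hypothesis hchi : majorana chi.

Lemma majorana_family : clifford_family chi.
Proof.
case: hchi => _ H; split=> [k|k l nkl].
  have := H k k; rewrite eqxx -mulr2n -scaler_nat => /(congr1 ( *:%R 2^-1)).
  by rewrite scalerA scale_scalar_mx mulVf ?pnatr_eq0 // scale1r mulmxE.
by apply/eqP; rewrite -addr_eq0 -mulmxE H (negPf nkl) -scalemx1 scale0r.
Qed.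

Lemma majorana_adjoint k : adjoint (chi k) = chi k.
Proof. by case: hchi => H _; apply: H. Qed.

Lemma majorana_even : ~~ odd #|{: 'I_(2 * m)}|.
Proof. by rewrite card_ord oddM. Qed.

Lemma majorana_dim : (2 ^ #|{: 'I_(2 * m)}| = 2 ^ m * 2 ^ m)%N.
Proof. by rewrite card_ord -expnD addnn mul2n. Qed.

Lemma muE v : mu chi v = 'i ^+ omegaL_form v *: ordered_prod chi v.
Proof. by rewrite /mu /ordered_prod [in RHS]big_mkcond. Qed.

(** The powers of ['i] in [mu] are invertible, so they can be absorbed into the scalars [c v]. *)
Lemma CliffordP g : Clifford chi g <-> string_normalizer chi g.
Proof.
have i0 n : ('i : C) ^+ n != 0 by rewrite expf_neq0 ?neq0Ci.
split=> [[ug [c [S E]]]|ng]; split; [by [] | | by case: ng | ].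
  move=> k; pose w : {ffun 'I_(2 * m) -> bool} := [ffun j => j == k].
  have wk : ordered_prod chi w = chi k.
    by rewrite /ordered_prod (big_pred1 k) // => j; rewrite ffunE.
  have := E w; rewrite !muE wk -scalemxAr -scalemxAl.
  move/(congr1 ( *:%R ('i ^+ omegaL_form w)^-1)).
  rewrite !scalerA mulVf // scale1r => H.
  by exists (('i ^+ omegaL_form w)^-1 * (c w * 'i ^+ omegaL_form (S w))), (S w); rewrite -H.
have [l Hl] := fin_all_exists (fun v =>
  conj_ordered_prod majorana_family majorana_adjoint majorana_dim v ng).
have [S HS] := fin_all_exists Hl.
exists (fun v => 'i ^+ omegaL_form v * l v * ('i ^+ omegaL_form (S v))^-1), S => v.
rewrite !muE -scalemxAr -scalemxAl -[adj g]/(adjoint g) (HS v).2 !scalerA.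
by rewrite mulfVK.
Qed.

End CliffordGroup.

(** * The parity operator and the p-Clifford group *)

Section Parity.
Variables (C : numClosedFieldType) (n : nat) (chi : 'I_(2 * n) -> 'M[C]_(2 ^ n)).
Hypothesis hchi : majorana chi.
Let cf := majorana_family hchi.
Let fH := majorana_adjoint hchi.
Let P := mu chi (allones n).

Lemma omegaL_form_allones : omegaL_form (allones n) = 'C(2 * n, 2).
Proof.
rewrite /omegaL_form -bin2_sum big_mkord; apply: eq_bigr => k _.
under eq_bigr => l _ do rewrite !ffunE.
by rewrite (big_ord_narrow (ltnW (ltn_ord k))) sum_nat_const card_ord muln1.
Qed.

(** The sign from reversing the full word cancels the sign from conjugating the power of ['i], as
    both have exponent ['C(2 * n, 2)]. *)
Lemma parity_adjoint : adjoint P = P.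
Proof.
rewrite /P muE adjointZ omegaL_form_allones.
have := prod_rev_sign cf (enum_uniq [pred k | allones n k]).
rewrite -adjoint_prod // -ordered_prodE -cardE => ->.
have -> : #|[pred k | allones n k]| = (2 * n)%N.
  by rewrite -[RHS]card_ord; apply: eq_card => k; rewrite !inE ffunE.
rewrite rmorphXn /= conjCi -[X in _ *: X]/(_ * _) -(signr_odd _ 'C(_, _)) mulr_sign.
rewrite (exprNn 'i) -(signr_odd _ 'C(_, _)) mulr_sign.
by case: ifP => // _; rewrite scaleNr scalerN opprK.
Qed.

Lemma parity_square : P *m P = 1%:M.
Proof.
rewrite -{2}parity_adjoint /P muE adjointZ -scalemxAl -scalemxAr.
rewrite [_ *m adjoint _](unitary_ordered_prod cf fH _) scalerA -normCK normrX normCi.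
by rewrite !expr1n scale1r.
Qed.

(** The full word has even length and contains [k] once, so the total sign is negative. *)
Lemma parity_anticomm k : chi k *m P = - (P *m chi k).
Proof.
rewrite /P muE -scalemxAr -scalemxAl generator_ordered_prod // ffunE.
have -> : #|[pred k | allones n k]| = (2 * n)%N.
  by rewrite -[RHS]card_ord; apply: eq_card => j; rewrite !inE ffunE.
by rewrite -signr_odd oddD oddM scaleN1r scalerN.
Qed.

Lemma Piplus_adjoint : adjoint (Piplus chi) = Piplus chi.
Proof.
by rewrite /Piplus adjointZ adjointD adjoint1 parity_adjoint fmorphV rmorph_nat.
Qed.

Lemma parity_Piplus : P *m Piplus chi = Piplus chi.
Proof. by rewrite /Piplus -scalemxAr mulmxDr mulmx1 parity_square addrC. Qed.

Lemma Piplus_proj : Piplus chi *m Piplus chi = Piplus chi.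
Proof.
rewrite {1}/Piplus -scalemxAl mulmxDl mul1mx parity_Piplus -mulr2n -scaler_nat.
by rewrite scalerA mulVf ?pnatr_eq0 // scale1r.
Qed.

Lemma Piplus_comm (A : 'M[C]_(2 ^ n)) : A *m P = P *m A ->
  A *m Piplus chi = Piplus chi *m A.
Proof.
by move=> cA; rewrite /Piplus -scalemxAr -scalemxAl mulmxDr mulmxDl mulmx1 mul1mx cA.
Qed.

(** Conjugation by a generator negates [P]. The index [k] guarantees that a generator exists; for
    [n = 0] the parity is the identity, of trace 1. *)
Lemma parity_trace (k : 'I_(2 * n)) : \tr P = 0.
Proof.
have : \tr P = - \tr P.
  have {1}-> : P = chi k *m (chi k *m P) by rewrite mulmxA mulmxE cf.1 mul1r.
  by rewrite mxtrace_mulC parity_anticomm mulNmx -mulmxA mulmxE cf.1 mulr1 raddfN.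
by move/eqP; rewrite -subr_eq0 opprK -mulr2n mulrn_eq0 /= => /eqP.
Qed.

Lemma pClifford_group : unitary_group (pClifford chi).
Proof.
have [G1 uG MG VG] := string_normalizer_group cf fH (majorana_even n) (majorana_dim n).
split=> [|g [[]]|g h [/(CliffordP hchi) Gg cg] [/(CliffordP hchi) Gh ch]
  |g [/(CliffordP hchi) Gg cg]] //.
- by split; [apply/(CliffordP hchi) | rewrite mul1mx mulmx1].
- by split; [apply/(CliffordP hchi); auto | rewrite -mulmxA ch !mulmxA cg].
split; first by apply/(CliffordP hchi); auto.
by have /(congr1 (@adjoint C _ _)) := cg; rewrite !adjointM -/P parity_adjoint.
Qed.

Lemma pClifford_transversal : exists s, Defs.transversal (pClifford chi) s.
Proof.
apply: (subgroup_transversal_exists cf fH (majorana_even n) (majorana_dim n)) => g [+ _].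
by move/(CliffordP hchi).
Qed.

Lemma Clifford_group : unitary_group (Clifford chi).
Proof.
have [G1 uG MG VG] := string_normalizer_group cf fH (majorana_even n) (majorana_dim n).
split=> [|g []|g h /(CliffordP hchi) Gg /(CliffordP hchi) Gh|g /(CliffordP hchi) Gg] //.
- exact/(CliffordP hchi).
- by apply/(CliffordP hchi); auto.
- by apply/(CliffordP hchi); auto.
Qed.

Lemma Clifford_transversal : exists s, Defs.transversal (Clifford chi) s.
Proof.
apply: (subgroup_transversal_exists cf fH (majorana_even n) (majorana_dim n)) => g.
by move/(CliffordP hchi).
Qed.

End Parity.

(** * Compression to the even sector and lifting back *)

Section Restriction.
Variables (C : numClosedFieldType) (m : nat).
Variables (chi : 'I_(2 * m.+1) -> 'M[C]_(2 ^ m.+1)) (chi' : 'I_(2 * m) -> 'M[C]_(2 ^ m)).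
Hypotheses (hchi : majorana chi) (hchi' : majorana chi').
Let cf := majorana_family hchi.
Let fH := majorana_adjoint hchi.
Let cf' := majorana_family hchi'.
Let fH' := majorana_adjoint hchi'.
Let P := mu chi (allones m.+1).

Fact embed_subproof : (2 * m <= 2 * m.+1)%N.
Proof. by rewrite leq_mul2l leqnSn orbT. Qed.

Fact pen_subproof : (2 * m < 2 * m.+1)%N.
Proof. by rewrite ltn_mul2l ltnSn. Qed.

Fact last_subproof : ((2 * m).+1 < 2 * m.+1)%N.
Proof. by rewrite mulnS. Qed.

Definition embed : 'I_(2 * m) -> 'I_(2 * m.+1) := widen_ord embed_subproof.
(** Indices start at 0, so [pen] and [last_ord] have values [2 * m] and [2 * m + 1]: these two
    generators have no counterpart in [chi']. *)
Definition pen : 'I_(2 * m.+1) := Ordinal pen_subproof.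
Definition last_ord : 'I_(2 * m.+1) := Ordinal last_subproof.
Let Q := chi pen.
Let L := chi last_ord.

Lemma index_cases (a : 'I_(2 * m.+1)) : [\/ exists k, a = embed k, a = pen | a = last_ord].
Proof.
have [lt|ge] := ltnP a (2 * m).
  by constructor 1; exists (Ordinal lt); apply: val_inj.
have : (a < (2 * m).+2)%N by have := ltn_ord a; rewrite {2}mulnS.
rewrite ltnS leq_eqVlt ltnS => /orP[/eqP E|le].
  by constructor 3; apply: val_inj.
by constructor 2; apply: val_inj; apply/eqP; rewrite eqn_leq /= le ge.
Qed.

Lemma embed_neq_last k : embed k != last_ord.
Proof. by rewrite -val_eqE /= ltn_eqF // ltnW // ltnS ltn_ord. Qed.

Lemma embed_neq_pen k : embed k != pen.
Proof. by rewrite -val_eqE /= ltn_eqF // ltn_ord. Qed.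

Lemma pen_neq_last : pen != last_ord.
Proof. by rewrite -val_eqE /= ltn_eqF. Qed.

Let sq a : chi a *m chi a = 1%:M := cf.1 a.
Let PH : adjoint P = P := parity_adjoint hchi.
Let PA a : chi a *m P = - (P *m chi a) := parity_anticomm hchi a.
Let anti a b (h : a != b) : chi a *m chi b = - (chi b *m chi a) := cf.2 a b h.

(** The factor ['i] makes a product of two anticommuting Hermitian involutions again a Hermitian
    involution. *)
Definition even_family k : 'M[C]_(2 ^ m.+1) := 'i *: (chi (embed k) *m L).

Lemma even_familyM k l : even_family k *m even_family l = chi (embed k) *m chi (embed l).
Proof.
rewrite /even_family -scalemxAl -scalemxAr scalerA -expr2 sqrCi scaleN1r !mulmxA.
rewrite -(mulmxA _ L) (anti (a := last_ord)) 1?eq_sym ?embed_neq_last //.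
by rewrite mulmxN mulNmx opprK !mulmxA -(mulmxA _ L L) sq mulmx1.
Qed.

Lemma even_family_clifford : clifford_family even_family.
Proof.
split=> [k|k l nkl]; rewrite -!mulmxE !even_familyM; first exact: sq.
by apply: anti; apply: contra nkl => /eqP/(congr1 val) /= /val_inj ->.
Qed.

Lemma even_family_adjoint k : adjoint (even_family k) = even_family k.
Proof.
rewrite /even_family adjointZ adjointM !fH conjCi.
by rewrite (anti (a := last_ord)) 1?eq_sym ?embed_neq_last // scalerN scaleNr opprK.
Qed.

Lemma even_family_parity k : even_family k *m P = P *m even_family k.
Proof.
rewrite /even_family -[LHS]scalemxAl -[RHS]scalemxAr -mulmxA (PA last_ord).
by rewrite mulmxN mulmxA PA mulNmx opprK mulmxA.
Qed.

Lemma even_family_pen k : even_family k *m Q = Q *m even_family k.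
Proof.
rewrite /even_family -scalemxAl -scalemxAr -mulmxA (anti (a := last_ord)).
  rewrite mulmxN mulmxA (anti (embed_neq_pen k)) mulNmx opprK mulmxA.
  by [].
by rewrite eq_sym pen_neq_last.
Qed.

(** All copies of [L] are collected on the right; each passage past an embedded generator costs a
    sign. *)
Lemma even_family_prod (s : seq 'I_(2 * m)) : exists2 l : C, l != 0 &
  \prod_(k <- s) even_family k = l *: (\prod_(k <- map embed s) chi k *m L ^+ size s).
Proof.
elim: s => [|x s [l l0 IH]].
  by exists 1; rewrite ?oner_neq0 // !big_nil expr0 scale1r mulmxE mulr1.
have LA : L *m (\prod_(k <- map embed s) chi k) =
    (-1) ^+ size s *: (\prod_(k <- map embed s) chi k *m L).
  rewrite [LHS](generator_move (map embed s) last_ord cf).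
  rewrite size_map (count_memPn _) ?addn0; last first.
    by apply/mapP => -[k _ /eqP]; rewrite eq_sym (negPf (embed_neq_last k)).
  by rewrite -[in LHS]signr_odd mulr_sign -[in RHS]signr_odd scaler_sign.
exists ('i * l * (-1) ^+ size s).
  by rewrite !mulf_neq0 ?neq0Ci // expf_neq0 // oppr_eq0 oner_neq0.
rewrite map_cons !big_cons IH -[LHS]/(even_family x *m (l *: _)) /= exprS.
rewrite -[chi _ * _]/(chi _ *m _) -[L * _]/(L *m _) /even_family -scalemxAl -scalemxAr.
rewrite scalerA -!mulmxA (mulmxA L) LA -scalemxAl -scalemxAr scalerA.
by rewrite !mulmxA.
Qed.

(* The full product of generators is the parity, so on the even sector the product
   of the two spare generators is a string of the even family. *)
Lemma pen_last : exists (l : C) (s : seq 'I_(2 * m)),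
  Q *m L = l *: (\prod_(k <- s) even_family k *m P).
Proof.
pose e := enum 'I_(2 * m).
have pe : perm_eq (enum [pred k | allones m.+1 k]) (map embed e ++ [:: pen; last_ord]).
  apply: uniq_perm; first exact: enum_uniq.
    rewrite cat_uniq map_inj_uniq ?enum_uniq; last by move=> a b /(congr1 val) /= /val_inj.
    rewrite /= inE pen_neq_last !andbT orbF negb_or.
    apply/andP; split; apply/mapP => -[k _ /eqP]; rewrite eq_sym.
      by rewrite (negPf (embed_neq_pen k)).
    by rewrite (negPf (embed_neq_last k)).
  move=> a; rewrite mem_enum !inE ffunE mem_cat !inE.
  case: (index_cases a) => [[k ->]|->|->]; rewrite ?eqxx ?orbT //.
  by rewrite map_f // mem_enum.
have [d Hd] := perm_prod_sign pe.
have [l l0 El] := even_family_prod e.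
have L1 : L ^+ size e = 1.
  by rewrite -cardE card_ord exprM expr2 [L * L]sq expr1n.
rewrite L1 -[1]/(1%:M) mulmx1 in El.
set Z := \prod_(k <- e) _ in El.
have EP : P = ('i ^+ 'C(2 * m.+1, 2) * (-1) ^+ d * l^-1) *: (Z *m (Q *m L)).
  rewrite /P muE omegaL_form_allones ordered_prodE Hd // big_cat El /=.
  rewrite big_cons big_seq1 -scalemxAl scalerA mulfVK // -scalerA; congr (_ *: _).
  by rewrite -signr_odd mulr_sign -(signr_odd _ d) scaler_sign.
set c := _ * _ * _ in EP.
have c0 : c != 0.
  by rewrite !mulf_neq0 ?invr_eq0 ?expf_neq0 ?neq0Ci // oppr_eq0 oner_neq0.
(* The reversed word is the adjoint of the unitary [Z], so multiplying by it removes [Z] from the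
   expression for [P]. *)
exists c^-1, (rev e); rewrite -adjoint_prod; last exact: even_family_adjoint.
have uZ := (unitaryP _).1 (unitary_prod even_family_clifford even_family_adjoint e).
by rewrite EP -scalemxAr scalerA mulVf // scale1r (mulmxA (adjoint _)) [_ *m Z]uZ mul1mx.
Qed.

Variable W : 'M[C]_(2 ^ m.+1, 2 ^ m).
Hypotheses (WW : adjoint W *m W = 1%:M) (WP : W *m adjoint W = Piplus chi).
Hypothesis evenW : forall k, even_family k *m W = W *m chi' k.

Lemma parity_W : P *m W = W.
Proof.
have E : Piplus chi *m W = W by rewrite -WP -mulmxA WW mulmx1.
by rewrite -{1}E mulmxA parity_Piplus.
Qed.

Lemma adjW_parity : adjoint W *m P = adjoint W.
Proof. by rewrite -{1}PH -adjointM parity_W. Qed.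

(** A single generator exchanges the two eigenspaces of [P], so its diagonal block vanishes. *)
Lemma odd_block a : adjoint W *m chi a *m W = 0.
Proof.
have E : adjoint W *m chi a *m W = - (adjoint W *m chi a *m W).
  rewrite -{2}parity_W mulmxA -(mulmxA _ _ P) PA mulmxN mulNmx.
  by rewrite mulmxA adjW_parity.
by move/eqP: E; rewrite -addr_eq0 -mulr2n -scaler_nat scaler_eq0 pnatr_eq0 => /eqP.
Qed.

Lemma even_prod_W (s : seq 'I_(2 * m)) :
  \prod_(k <- s) even_family k *m W = W *m \prod_(k <- s) chi' k.
Proof.
elim: s => [|x s IH]; first by rewrite !big_nil mul1mx mulmx1.
by rewrite !big_cons -[_ * _]/(_ *m _) -mulmxA IH mulmxA evenW -mulmxA.
Qed.

(** Inserting [L *m L = 1] between the two generators reduces to pairs containing [L]. Such a pair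
    is a multiple of [even_family], the product treated in [pen_last], or the identity. *)
Lemma pair_W a b : exists2 M, is_string chi' M & chi a *m chi b *m W = W *m M.
Proof.
have toL c : exists2 M, is_string chi' M & chi c *m L *m W = W *m M.
  case: (index_cases c) => [[k ->]|->|->].
  - exists (- 'i *: chi' k); first exact/is_stringZ/is_string_gen.
    rewrite -scalemxAr -evenW /even_family -scalemxAl scalerA mulNr -expr2 sqrCi.
    by rewrite opprK scale1r.
  - have [l [s ->]] := pen_last; exists (l *: \prod_(k <- s) chi' k).
      exact/is_stringZ/is_string_prod.
    by rewrite -scalemxAl -mulmxA parity_W even_prod_W -scalemxAr.
  - by exists 1%:M; [exact: is_string1 | rewrite sq mul1mx mulmx1].
have [M sM EM] := toL a.
have [N sN EN] : exists2 N, is_string chi' N & L *m chi b *m W = W *m N.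
  have [N sN EN] := toL b.
  have [->|nb] := eqVneq b last_ord.
    by exists 1%:M; [exact: is_string1 | rewrite sq mul1mx mulmx1].
  exists (-1 *: N); first exact: is_stringZ.
  by rewrite (anti (a := last_ord)) 1?eq_sym // mulNmx EN -scalemxAr scaleN1r.
exists (M *m N); first exact: is_stringM.
rewrite mulmxA -EM -[RHS]mulmxA -EN !mulmxA -(mulmxA _ L L) sq mulmx1.
by [].
Qed.

(** Words of even length split into pairs. Words of odd length compress to zero, which is the zero
    multiple of the empty string. *)
Lemma restrict_string M : is_string chi M -> is_string chi' (adjoint W *m M *m W).
Proof.
have even_case k (s : seq 'I_(2 * m.+1)) : size s = k.*2 ->
    exists2 N, is_string chi' N & \prod_(k <- s) chi k *m W = W *m N.
  elim: k s => [|k IH] [|a [|b s]] //=.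
    by exists 1%:M; [exact: is_string1 | rewrite big_nil mul1mx mulmx1].
  rewrite doubleS => -[/IH[N sN EN]]; have [N' sN' EN'] := pair_W a b.
  exists (N' *m N); first exact: is_stringM.
  by rewrite !big_cons mulrA -[_ * _]/(_ *m _) -mulmxA EN mulmxA EN' -mulmxA.
move=> [l [v ->]]; rewrite -scalemxAr -scalemxAl; apply: is_stringZ.
rewrite ordered_prodE; move: (enum _) => s.
have [os|es] := boolP (odd (size s)); last first.
  have [N sN EN] := even_case (size s)./2 s (esym (even_halfK es)).
  by rewrite -mulmxA EN mulmxA WW mul1mx.
case: s os => [|a s] //= os.
have [N sN EN] := even_case (size s)./2 s (esym (even_halfK os)).
rewrite big_cons -[chi a * _]/(chi a *m _) (mulmxA (adjoint W)) -(mulmxA _ _ W) EN.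
rewrite mulmxA odd_block mul0mx.
by rewrite -(scale0r (1%:M : 'M[C]_(2 ^ m))); exact/is_stringZ/is_string1.
Qed.

Definition restrict (g : 'M[C]_(2 ^ m.+1)) : 'M[C]_(2 ^ m) := adjoint W *m g *m W.

Lemma adjW_Piplus : adjoint W *m Piplus chi = adjoint W.
Proof. by rewrite -WP mulmxA WW mul1mx. Qed.

(** The inserted [W *m adjoint W] is [Piplus chi], which moves past [g] and is absorbed by
    [adjoint W]. *)
Lemma restrictM g h : g *m P = P *m g -> restrict (g *m h) = restrict g *m restrict h.
Proof.
move=> cg; rewrite /restrict !mulmxA -(mulmxA _ W) WP -(mulmxA _ g (Piplus chi)).
by rewrite (Piplus_comm cg) mulmxA adjW_Piplus.
Qed.

Lemma restrict_adjoint g : restrict (adjoint g) = adjoint (restrict g).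
Proof. by rewrite /restrict !adjointM adjointK mulmxA. Qed.

Lemma restrict_Clifford g : pClifford chi g -> Clifford chi' (restrict g).
Proof.
move=> [/(CliffordP hchi)[ug sg] cg].
have cag : adjoint g *m P = P *m adjoint g.
  by have /(congr1 (@adjoint C _ _)) := cg; rewrite !adjointM PH.
apply/CliffordP => //; split=> [|k].
  rewrite /unitary -[adj _]/(adjoint _) -restrict_adjoint -restrictM //.
  by rewrite [g *m _]ug /restrict mulmx1 WW.
(* The conjugate of [chi' k] thus becomes the compression of the conjugate of a string of [chi]. *)
have -> : chi' k = restrict (even_family k).
  by rewrite /restrict -mulmxA evenW mulmxA WW mul1mx.
rewrite -restrict_adjoint -!restrictM //.
  apply: restrict_string; apply: (conj_string cf); first by split.
  apply: is_stringZ; apply: is_stringM => //; exact: is_string_gen.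
by rewrite -mulmxA even_family_parity mulmxA cg !mulmxA.
Qed.

Lemma restrict_trace g h : g *m P = P *m g -> h *m P = P *m h ->
  \tr (Piplus chi *m g *m adj h) = \tr (restrict g *m adj (restrict h)).
Proof.
move=> cg ch; rewrite -[adj (restrict h)]/(adjoint _) -restrict_adjoint -restrictM //.
by rewrite /restrict -WP [RHS]mxtrace_mulC !mulmxA.
Qed.

(** Block diagonal for the parity: [X] acts on the even sector and is copied to the odd sector by
    [Q]. *)
Definition lift_mx (X : 'M[C]_(2 ^ m)) : 'M[C]_(2 ^ m.+1) :=
  W *m X *m adjoint W + Q *m (W *m X *m adjoint W) *m Q.

(** Cross terms contain the block [adjoint W *m Q *m W], which is zero. *)
Lemma lift_mxM X Y : lift_mx X *m lift_mx Y = lift_mx (X *m Y).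
Proof.
have B := odd_block pen; rewrite -/Q in B.
have B' A (Z : 'M[C]_(2 ^ m, A)) : adjoint W *m (Q *m (W *m Z)) = 0.
  by rewrite !mulmxA B mul0mx.
have I' A (Z : 'M[C]_(2 ^ m, A)) : adjoint W *m (W *m Z) = Z.
  by rewrite mulmxA WW mul1mx.
have Q' A (Z : 'M[C]_(2 ^ m.+1, A)) : Q *m (Q *m Z) = Z.
  by rewrite mulmxA sq mul1mx.
rewrite /lift_mx mulmxDl !mulmxDr -!mulmxA !I' !Q' !B' !I' !mulmx0.
by rewrite !addr0 add0r.
Qed.

Lemma lift_mx1 : lift_mx 1%:M = 1%:M.
Proof.
rewrite /lift_mx mulmx1 WP /Piplus -scalemxAr -scalemxAl -scalerDr.
rewrite mulmxDr mulmx1 PA mulmxDl mulNmx -mulmxA sq mulmx1.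
rewrite addrACA subrr addr0 -mulr2n -scaler_nat scalerA mulVf ?pnatr_eq0 //.
by rewrite scale1r.
Qed.

Lemma lift_mx_adjoint X : adjoint (lift_mx X) = lift_mx (adjoint X).
Proof. by rewrite /lift_mx adjointD !adjointM !fH adjointK !mulmxA. Qed.

Lemma lift_mxZ a X : lift_mx (a *: X) = a *: lift_mx X.
Proof.
by rewrite /lift_mx scalerDr -!(scalemxAr, scalemxAl).
Qed.

(** [even_family k] commutes with [Q], so it factors out of both blocks and leaves the lift of the
    identity. *)
Lemma lift_mx_gen k : lift_mx (chi' k) = even_family k.
Proof.
have E : lift_mx (chi' k) = even_family k *m lift_mx 1%:M.
  rewrite /lift_mx mulmx1 -evenW mulmxDr !mulmxA even_family_pen.
  by [].
by rewrite E lift_mx1 mulmx1.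
Qed.

Lemma lift_mx_prod (s : seq 'I_(2 * m)) :
  lift_mx (\prod_(k <- s) chi' k) = \prod_(k <- s) even_family k.
Proof.
elim: s => [|x s IH]; first by rewrite !big_nil lift_mx1.
by rewrite !big_cons -IH -lift_mx_gen -[RHS]/(_ *m _) lift_mxM.
Qed.

Lemma even_family_string k : is_string chi (even_family k).
Proof. by apply: is_stringZ; apply: is_stringM => //; apply: is_string_gen. Qed.

Lemma lift_mx_string X : is_string chi' X -> is_string chi (lift_mx X).
Proof.
move=> [l [v ->]]; rewrite lift_mxZ; apply: is_stringZ.
rewrite ordered_prodE lift_mx_prod; elim: (enum _) => [|x s IH].
  by rewrite big_nil; apply: is_string1.
by rewrite big_cons; apply: is_stringM => //; apply: even_family_string.
Qed.

Lemma lift_mx_pen X : lift_mx X *m Q = Q *m lift_mx X.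
Proof.
rewrite /lift_mx mulmxDl mulmxDr addrC !mulmxA sq mul1mx; congr (_ + _).
by rewrite -!mulmxA sq mulmx1.
Qed.

Lemma lift_mx_parity X : lift_mx X *m P = P *m lift_mx X.
Proof.
set Y := W *m X *m adjoint W.
have YP : Y *m P = Y by rewrite /Y -[LHS]mulmxA adjW_parity.
have PY : P *m Y = Y by rewrite /Y !mulmxA parity_W.
rewrite /lift_mx -/Y; clearbody Y; rewrite mulmxDl mulmxDr YP PY; congr (_ + _).
have QP : Q *m P = - (P *m Q) := PA pen.
have PQ : P *m Q = - (Q *m P) by rewrite QP opprK.
rewrite -[LHS]mulmxA QP mulmxN (mulmxA _ P) -(mulmxA Q Y P) YP.
by rewrite !mulmxA PQ !mulNmx -(mulmxA Q P) PY.
Qed.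

Lemma restrict_lift h : restrict (lift_mx h) = h.
Proof.
rewrite /restrict /lift_mx mulmxDr mulmxDl !mulmxA WW mul1mx -(mulmxA h) WW mulmx1.
by rewrite odd_block !mul0mx addr0.
Qed.

Lemma lift_pClifford h : Clifford chi' h -> pClifford chi (lift_mx h).
Proof.
move=> /(CliffordP hchi') nh; have [uh _] := nh.
split; last exact: lift_mx_parity.
set g := lift_mx h.
have ug : unitary g.
  by rewrite /unitary -[adj _]/(adjoint _) lift_mx_adjoint lift_mxM [h *m _]uh lift_mx1.
have ag := (unitaryP _).1 ug.
(* Matrices whose conjugate is a string are closed under products and scaling. They include the even
   words, [Q] and [P], hence also [L] through [pen_last], and these generate every [chi a]. *)
pose conj_str M := is_string chi (g *m M *m adjoint g).
have conjM M N : conj_str M -> conj_str N -> conj_str (M *m N).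
  move=> sM sN; have := is_stringM cf sM sN.
  by rewrite /conj_str !mulmxA -(mulmxA _ (adjoint g) g) ag mulmx1.
have conjZ a M : conj_str M -> conj_str (a *: M).
  by rewrite /conj_str -scalemxAr -scalemxAl; apply: is_stringZ.
have conj_comm M : g *m M = M *m g -> is_string chi M -> conj_str M.
  by rewrite /conj_str => -> sM; rewrite -mulmxA [g *m _]ug mulmx1.
have conjE (s : seq 'I_(2 * m)) : conj_str (\prod_(k <- s) even_family k).
  rewrite /conj_str -lift_mx_prod lift_mx_adjoint !lift_mxM; apply: lift_mx_string.
  by apply: (conj_string cf') => //; apply: is_string_prod.
have conjQ : conj_str Q by apply: conj_comm; [exact: lift_mx_pen | exact: is_string_gen].
have conjP : conj_str P.
  apply: conj_comm; first exact: lift_mx_parity.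
  by rewrite /P muE; apply: is_stringZ; eexists 1, _; rewrite scale1r.
have conjL : conj_str L.
  have -> : L = Q *m (Q *m L) by rewrite mulmxA sq mul1mx.
  by have [l [s ->]] := pen_last; auto.
apply/(CliffordP hchi); split=> // a; rewrite -/(conj_str _).
case: (index_cases a) => [[k ->]|->|->] //.
have -> : chi (embed k) = - 'i *: (\prod_(j <- [:: k]) even_family j *m L).
  rewrite big_seq1 /even_family -scalemxAl -mulmxA sq mulmx1 scalerA mulNr -expr2 sqrCi.
  by rewrite opprK scale1r.
by auto.
Qed.

End Restriction.

(** * Equality of the two frame potentials *)

Lemma Piplus_trace (C : numClosedFieldType) (m : nat)
  (chi : 'I_(2 * m.+1) -> 'M[C]_(2 ^ m.+1)) :
  majorana chi -> \tr (Piplus chi) = (2 ^ m)%:R.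
Proof.
move=> hchi; rewrite /Piplus linearZ linearD /= (parity_trace hchi (pen m)) addr0 mxtrace1.
by rewrite expnS natrM mulKf ?pnatr_eq0.
Qed.

(** The choice operator behind [reps] has the intended value only once some transversal is known to
    exist. *)
Lemma reps_transversal (C : numClosedFieldType) (d : nat) (G : 'M[C]_d -> Prop) :
  (exists s, Defs.transversal G s) -> Defs.transversal G (reps G).
Proof. exact: epsilon_spec. Qed.

Lemma frame_pot_parity_restriction (C : numClosedFieldType) (m t : nat)
  (chi : 'I_(2 * m.+1) -> 'M[C]_(2 ^ m.+1)) (chi' : 'I_(2 * m) -> 'M[C]_(2 ^ m)) :
  majorana chi -> majorana chi' ->
  frame_pot_plus chi (pClifford chi) t = frame_pot (Clifford chi') t.
Proof.
move=> hchi hchi'.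
have [W [WW WP evenW]] := isometric_intertwiner (even_family_clifford hchi)
  (majorana_family hchi') (even_family_adjoint hchi) (majorana_adjoint hchi')
  (majorana_even m) (majorana_dim m) (Piplus_proj hchi) (Piplus_adjoint hchi)
  (Piplus_trace hchi) (fun k => Piplus_comm (even_family_parity hchi k)).
have ts := reps_transversal (pClifford_transversal hchi).
have ts' := reps_transversal (Clifford_transversal hchi').
rewrite /frame_pot_plus /frame_pot /frame_pot_P.
set s := reps _ in ts *; set s' := reps _ in ts' *.
pose F (A B : 'M[C]_(2 ^ m)) : C := `|\tr (A *m adj B)| ^+ (2 * t).
have Fr A B B' : phase_eq B B' -> F A B = F A B'.
  move=> [l [nl ->]]; rewrite /F -[adj (_ *: _)]/(adjoint _) adjointZ -scalemxAr linearZ /=.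
  by rewrite normrM norm_conjC nl mul1r.
have Fl A A' B : phase_eq A A' -> F A B = F A' B.
  by move=> [l [nl ->]]; rewrite /F -scalemxAl linearZ /= normrM nl mul1r.
have mean (H : 'M[C]_(2 ^ m) -> C) : (forall A B, phase_eq A B -> H A = H B) ->
    (size s)%:R^-1 * \sum_(U <- s) H (restrict W U) = (size s')%:R^-1 * \sum_(V <- s') H V.
  move=> HP; apply: (transversal_mean (phi := restrict W) (pClifford_group hchi)
    (Clifford_group hchi') _ _ _ _ ts ts' HP).
  - by move=> g; apply: restrict_Clifford.
  - by move=> g h [_ cg] _; apply: (restrictM WW WP).
  - by move=> l g; rewrite /restrict -scalemxAr -scalemxAl.
  - move=> h Gh; exists (lift_mx chi W h); first exact: lift_pClifford Gh.
    exact: restrict_lift.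
(* The double mean is written as nested single means, so that the surjection can be applied first to
   [V] and then to [U]. *)
transitivity ((size s)%:R^-1 * \sum_(U <- s)
    ((size s)%:R^-1 * \sum_(V <- s) F (restrict W U) (restrict W V))).
  rewrite -mulr_sumr mulrA -expr2 exprVn; congr (_ * _).
  apply: eq_big_seq => U sU; apply: eq_big_seq => V sV.
  have [_ cU] : pClifford chi U by case: ts => /(_ U sU).
  have [_ cV] : pClifford chi V by case: ts => /(_ V sV).
  by rewrite (restrict_trace WW WP).
under eq_bigr => U _ do rewrite (mean (F (restrict W U)) (Fr _)).
rewrite (mean (fun A => (size s')%:R^-1 * \sum_(V <- s') F A V)) => [|A B AB]; last first.
  by congr (_ * _); apply: eq_bigr => V _; apply: Fl.
rewrite -mulr_sumr mulrA -expr2 exprVn; congr (_ * _).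
by apply: eq_bigr => U _; apply: eq_bigr => V _; rewrite mul1mx.
Qed.

Theorem mainTheorem16 (C : numClosedFieldType) (n t : nat)
  (hn : (2 <= n)%N) (ht : (1 <= t)%N)
  (chi : 'I_(2 * n) -> 'M[C]_(2 ^ n)) (hchi : majorana chi)
  (chi' : 'I_(2 * (n - 1)) -> 'M[C]_(2 ^ (n - 1))) (hchi' : majorana chi') :
  frame_pot_plus chi (pClifford chi) t = frame_pot (Clifford chi') t.
Proof.
(* With [n] a successor, [n - 1] reduces inside the type of [chi']. *)
case: n hn chi hchi chi' hchi' => // n _ chi hchi; rewrite subn1 /= => chi' hchi'.
exact: frame_pot_parity_restriction.
Qed.
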